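(* Let $G$ be a (finite) graph, let $k_{\max}=|V(G)|-1$, and let $\ell_{\max}$ be the maximum length of an Eulerian path in $G$. Put $EMC_{\max}(G)=EMC_{k_{\max},\ell_{\max}}(G)$ and $EMH_{\max}(G)=EMH_{k_{\max},\ell_{\max}}(G)$. Then $EMH_{\max}(G)$ is always nontrivial, and in particular $EMH_{\max}(G)=EMC_{\max}(G)$.
   Context: Graphs are finite and undirected, with vertex set $V(G)$; $d(a,b)$ is the least number of edges in a walk from $a$ to $b$ ($\infty$ if none). A $k$-path is a tuple $(v_0,\dots,v_k)\in V(G)^{k+1}$ with $v_i\ne v_{i+1}$ and $d(v_i,v_{i+1})<\infty$ for $0\le i\le k-1$; its length is $\sum_{i=0}^{k-1}d(v_i,v_{i+1})$. It is an Eulerian $k$-path if its entries are pairwise distinct; an Eulerian path is an Eulerian $k$-path for some $k\ge0$. $EMC_{k,\ell}(G)$ is the free abelian group on Eulerian $k$-paths of length $\ell$. The differential $\partial_{k,\ell}:EMC_{k,\ell}(G)\to EMC_{k-1,\ell}(G)$ is $\sum_{i=1}^{k-1}(-1)^i\partial^i_{k,\ell}$, where $\partial^i_{k,\ell}(v_0,\dots,v_k)$ is the tuple with $v_i$ deleted if that tuple still has length $\ell$, and $0$ otherwise. $EMH_{k,\ell}(G)=\ker\partial_{k,\ell}/\operatorname{im}\partial_{k+1,\ell}$.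
   Formalization: Nontriviality of EMH_max(G) is claimed only for connected G: a disconnected graph has no Eulerian k_max-path, so EMC_max(G) = EMH_max(G) = 0 (e.g. two isolated vertices). The equality EMH_max(G) = EMC_max(G) is stated for every graph having a maximal length. *)

(* Defs.v *)
From HB Require Import structures.
From mathcomp Require Import all_boot all_order all_algebra.
From mathcomp Require Import generic_quotient ring_quotient.
From mathcomp Require Import boolp freeg.

Set Implicit Arguments.
Unset Strict Implicit.
Unset Printing Implicit Defensive.

Import GRing.Theory.
Local Open Scope ring_scope.

(* A graph is given by its adjacency relation [e] on a finite vertex type. *)
Section Distance.
Variables (V : finType) (e : rel V).

Definition walk (n : nat) (a b : V) : bool :=
  [exists p : n.-tuple V, path e a p && (last a p == b)].

Lemma walk_exP a b : reflect (exists n, walk n a b) (connect e a b).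
Proof.
apply: (iffP connectP) => [[p pP ->]|[n /existsP[p /andP[pP /eqP <-]]]].
  by exists (size p); apply/existsP; exists (in_tuple p); rewrite pP eqxx.
by exists p.
Qed.

(* [None] stands for infinite distance. *)
Definition dist (a b : V) : option nat :=
  if @walk_exP a b is ReflectT ex then Some (ex_minn ex) else None.

Lemma distP a b n :
  dist a b = Some n <-> walk n a b /\ (forall m, walk m a b -> (n <= m)%N).
Proof.
rewrite /dist; case: walk_exP => [ex|nex]; last first.
  by split=> // -[wn _]; case: nex; exists n.
case: ex_minnP => m wm minm; split=> [[<-] //|[wn minn]].
by congr Some; apply/eqP; rewrite eqn_leq minm ?minn.
Qed.

Lemma dist_infP a b : dist a b = None <-> (forall n, ~~ walk n a b).
Proof.
rewrite /dist; case: walk_exP => [[n wn]|nex]; split=> //.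
  by move/(_ n); rewrite wn.
by move=> _ n; apply/negP => wn; case: nex; exists n.
Qed.

End Distance.

Section Paths.
Variables (V : finType) (e : rel V).

Definition is_kpath (k : nat) (s : seq V) : bool :=
  (size s == k.+1) && sorted [rel a b | (a != b) && (dist e a b != None)] s.

(* Infinite distances are counted as 0; none occurs in a k-path. *)
Definition path_length (s : seq V) : nat :=
  if s is a :: s' then sumn (pairmap (fun x y => odflt 0%N (dist e x y)) a s')
  else 0.

Definition is_eulerian (k : nat) (s : seq V) : bool := is_kpath k s && uniq s.

Definition is_max_eulerian_length (l : nat) : Prop :=
  (exists k s, is_eulerian k s /\ path_length s = l) /\
  (forall k s, is_eulerian k s -> (path_length s <= l)%N).

Lemma max_eulerian_length_exists :
  (0 < #|V|)%N -> exists l, is_max_eulerian_length l.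
Proof.
move=> /card_gt0P[v _].
have H : exists n, `[< exists k s, is_eulerian k s /\ path_length s = n >].
  by exists 0%N; apply/asboolP; exists 0%N, [:: v].
have B n : `[< exists k s, is_eulerian k s /\ path_length s = n >] ->
    (n <= #|V| * \max_(p : V * V) odflt 0 (dist e p.1 p.2))%N.
  move=> /asboolP[k [s [/andP[_ un] <-]]].
  apply: (@leq_trans (size s * \max_(p : V * V) odflt 0 (dist e p.1 p.2))%N).
    case: s un => // a s _; rewrite /path_length /= mulSn.
    apply: leq_trans (leq_addl _ _).
    elim: s a => //= b s IH a; rewrite mulSn leq_add //.
    exact: (leq_bigmax (a, b)).
  by rewrite leq_mul2r -(card_uniqP un) max_card orbT.
exists (ex_maxn H B); case: ex_maxnP => m /asboolP hm mm; split=> // k s eu.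
by apply: mm; apply/asboolP; exists k, s.
Qed.

Record epath (k l : nat) := EPath {
  epath_seq :> seq V;
  _ : is_eulerian k epath_seq && (path_length epath_seq == l)
}.
HB.instance Definition _ k l := [isSub for @epath_seq k l].
HB.instance Definition _ k l := [Choice of epath k l by <:].

Definition EMC (k l : nat) : Type := {freeg (epath k l) / int}.
HB.instance Definition _ k l := GRing.Lmodule.on (EMC k l).

Definition delete (i : nat) (s : seq V) : seq V := take i s ++ drop i.+1 s.

(* Deleting an entry of an Eulerian k-path leaves pairwise distinct entries at
   finite distances, so [insub] only tests that the length is still [l].  For
   k = 0 the differential is 0, and its codomain (degree -1) is irrelevant. *)
Definition face (k l i : nat) (p : epath k l) : EMC k.-1 l :=
  if insub (delete i (val p)) is Some q then << (q : epath k.-1 l) >> else 0.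

Definition boundary (k l : nat) : EMC k l -> EMC k.-1 l :=
  fglift (fun p => \sum_(1 <= i < k) (-1) ^+ i *: face i p).

Lemma boundary_is_additive k l : zmod_morphism (@boundary k l).
Proof. exact: lift_is_additive. Qed.
HB.instance Definition _ k l :=
  GRing.isZmodMorphism.Build (EMC k l) (EMC k.-1 l) (@boundary k l)
    (@boundary_is_additive k l).

Definition is_cycle (k l : nat) (x : EMC k l) : bool := boundary x == 0.

Lemma is_cycle_closed k l : zmod_closed (@is_cycle k l).
Proof.
split=> [|x y]; rewrite !unfold_in /is_cycle ?raddf0 // => /eqP x0 /eqP y0.
by rewrite raddfB /= x0 y0 subr0.
Qed.
HB.instance Definition _ k l :=
  GRing.isZmodClosed.Build (EMC k l) (@is_cycle k l) (@is_cycle_closed k l).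

Record cycles (k l : nat) := Cycle {
  cycle_chain :> EMC k l;
  _ : is_cycle cycle_chain
}.
HB.instance Definition _ k l := [isSub for @cycle_chain k l].
HB.instance Definition _ k l := [Choice of cycles k l by <:].
HB.instance Definition _ k l := [SubChoice_isSubZmodule of cycles k l by <:].

Definition is_boundary (k l : nat) (z : cycles k l) : bool :=
  `[< exists y : EMC k.+1 l, boundary y = val z >].

Lemma is_boundary_closed k l : zmod_closed (@is_boundary k l).
Proof.
split=> [|x y]; rewrite !unfold_in /is_boundary.
  by apply/asboolP; exists 0; rewrite raddf0.
move=> /asboolP[u ux] /asboolP[v vy]; apply/asboolP; exists (u - v).
by rewrite [LHS]raddfB /= ux vy.
Qed.
HB.instance Definition _ k l :=
  GRing.isZmodClosed.Build (cycles k l) (@is_boundary k l)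
    (@is_boundary_closed k l).

Definition EMH (k l : nat) : Type :=
  Quotient.quot (GRing.ZmodClosed.clone _ (@is_boundary k l) _).
HB.instance Definition _ k l := GRing.Zmodule.on (EMH k l).

Definition hclass (k l : nat) (z : cycles k l) : EMH k l :=
  (\pi_(EMH k l) z)%qT.

End Paths.

Definition is_connected (V : finType) (e : rel V) : Prop :=
  forall a b : V, connect e a b.

(* Main.v *)
(* A path of maximal length visits every vertex reachable from its end, since
   appending a missed vertex would lengthen it.  So no deletion preserves the
   maximal length and the differential vanishes on EMC_max, while pigeonhole
   leaves no Eulerian path in the next degree: homology equals chains.  When
   the graph is connected, a longest path visits all vertices, so EMC_max is
   nonzero. *)
From HB Require Import structures.
Require Import Defs.
From mathcomp Require Import all_boot all_order all_algebra.
From mathcomp Require Import generic_quotient ring_quotient boolp freeg.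

Set Implicit Arguments.
Unset Strict Implicit.
Unset Printing Implicit Defensive.

Import GRing.Theory.
Local Open Scope ring_scope.

Section EulerianPaths.
Variables (V : finType) (e : rel V).

Lemma dist_connect (a b : V) : (dist e a b != None) = connect e a b.
Proof. by rewrite /dist; case: walk_exP. Qed.

Lemma dist_gt0 (a b : V) :
  a != b -> connect e a b -> (0 < odflt 0 (dist e a b))%N.
Proof.
move=> ab; rewrite -dist_connect; case E: (dist e a b) => [n|] //= _.
case: n E => // /distP[/existsP[p /andP[_]]].
(* Distance 0 would be realised by the empty walk, which ends where it starts. *)
by rewrite tuple0 /= (negbTE ab).
Qed.

Lemma path_length_rcons (a : V) (s : seq V) (v : V) :
  path_length e (rcons (a :: s) v) =
  (path_length e (a :: s) + odflt 0 (dist e (last a s) v))%N.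
Proof. by rewrite /path_length /= -cats1 pairmap_cat sumn_cat /= addn0. Qed.

Lemma eulerian_rcons k (a : V) (s : seq V) (v : V) :
    is_eulerian e k (a :: s) -> v \notin a :: s -> connect e (last a s) v ->
  is_eulerian e k.+1 (rcons (a :: s) v).
Proof.
move=> /andP[/andP[/eqP sz so] un] vN cv.
rewrite /is_eulerian /is_kpath size_rcons sz eqxx rcons_uniq vN un andbT /=.
rewrite rcons_path (so : path _ _ _) /= dist_connect cv !andbT.
by apply: contraNneq vN => <-; exact: mem_last.
Qed.

Lemma eulerian_lt_card k s : is_eulerian e k s -> (k < #|V|)%N.
Proof. by move=> /andP[/andP[/eqP <- _] /card_uniqP <-]; exact: max_card. Qed.

(** The degree [k] is left free: the lemma serves both a face, one degree below the top, and a
    longest path whose degree is not yet known. *)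
Lemma max_eulerian_full k l s a :
    is_max_eulerian_length e l -> is_eulerian e k s -> path_length e s = l ->
    {in s, forall x, connect e x a} -> a \in s.
Proof.
move=> [_ lmax] eu sl ca; apply/negPn/negP => aN.
case: s eu sl ca aN => [|b s] // eu sl ca aN.
have cl : connect e (last b s) a by apply: ca; exact: mem_last.
have := lmax _ _ (eulerian_rcons eu aN cl).
rewrite path_length_rcons sl leqNgt -[X in (X < _)%N]addn0 ltn_add2l dist_gt0 //.
by apply: contraNneq aN => <-; exact: mem_last.
Qed.

(** Every entry is reachable from the first one, and symmetry allows travelling back to it. *)
Lemma eulerian_connect (e_sym : symmetric e) k s :
  is_eulerian e k s -> {in s &, forall x y, connect e x y}.
Proof.
move=> /andP[/andP[_ so] _].
case: s so => [|a s] // so.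
have ca x : x \in a :: s -> connect e a x.
  move: so => /=; elim: s a x => [|b s IH] a x /=.
    by rewrite inE => _ /eqP->.
  case/andP=> /andP[_ +] /IH {}IH; rewrite dist_connect => ab.
  by rewrite inE => /predU1P[->//|/IH]; exact: connect_trans.
move=> x y /ca ax /ca; apply: connect_trans.
by rewrite (sym_connect_sym e_sym).
Qed.

Lemma boundary_eq0 k l (x : EMC e k l) :
  (forall (p : epath e k l) i, (0 < i < k)%N -> face i p = 0) -> boundary x = 0.
Proof.
move=> f0; rewrite -[x]freeg_sumE [LHS]raddf_sum /=.
apply: big1 => p _; rewrite /boundary liftU big_nat big1 ?scaler0 // => i ik.
by rewrite f0 // scaler0.
Qed.

(* If deleting the entry [v] preserved the length, the shorter path could be
   extended by [v] at its end, beyond the maximal length. *)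
Lemma face_max (e_sym : symmetric e) l i (p : epath e #|V|.-1 l) :
  is_max_eulerian_length e l -> (0 < i < #|V|.-1)%N -> face i p = 0.
Proof.
move=> lmax ik; rewrite /face; case: insubP => // q qP _.
have /andP[pe _] := valP p; case/andP: qP => qe /eqP ql.
have /andP[/andP[/eqP sp _] up] := pe.
have isz : (i < size (val p))%N by rewrite sp; have /andP[_ /ltnW] := ik.
case E: (val p) => [|v0 s0]; first by rewrite E in isz.
pose v := nth v0 (val p) i.
have ps : val p = take i (val p) ++ v :: drop i.+1 (val p).
  by rewrite -drop_nth // cat_take_drop.
have vp : v \in val p by exact: mem_nth.
(* This membership is absurd: moving [v] to the front of [val p] shows, by uniqueness of entries,
   that [v] does not occur in the rest. *)
suff : v \in delete i (val p).
  move: up; rewrite {1}ps -cat_rcons -cats1 -catA uniq_catCA /=.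
  by rewrite -/(delete i (val p)) => /andP[/negbTE->].
apply: (max_eulerian_full lmax qe ql) => x xq.
apply: (eulerian_connect e_sym pe) => //.
by move: xq; rewrite ps /delete !mem_cat inE -ps => /orP[]->; rewrite ?orbT.
Qed.

Lemma boundary_max (e_sym : symmetric e) l (x : EMC e #|V|.-1 l) :
  is_max_eulerian_length e l -> boundary x = 0.
Proof. by move=> lmax; apply: boundary_eq0 => p i; exact: face_max. Qed.

(** There are no generators in this degree, so the condition on faces is vacuous; the bound used
    also holds when [V] is empty. *)
Lemma boundary_above_max l (x : EMC e #|V|.-1.+1 l) : boundary x = 0.
Proof.
apply: boundary_eq0 => p i _; have /andP[/eulerian_lt_card] := valP p.
by rewrite ltnNge leqSpred.
Qed.

(** Maximality of [l] provides a path in some degree [k]; connectedness makes it visit every vertex,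
    which forces [k] to be the top degree. *)
Lemma max_epath_exists l :
  is_connected e -> is_max_eulerian_length e l ->
  inhabited (epath e #|V|.-1 l).
Proof.
move=> conn lmax; have [[k [s [se sl]]] _] := lmax.
suff ks : #|V|.-1 = k.
  have sP : is_eulerian e #|V|.-1 s && (path_length e s == l).
    by rewrite ks se sl eqxx.
  by split; exact: EPath sP.
have /andP[/andP[/eqP sz _] /card_uniqP us] := se.
suff -> : #|V| = k.+1 by [].
rewrite -sz -us; apply: eq_card => a; rewrite inE; apply/esym.
by apply: (max_eulerian_full lmax se sl).
Qed.

End EulerianPaths.

Section Homology.
Variables (V : finType) (e : rel V) (k l : nat).
Hypothesis cycle_all : forall x : EMC e k l, is_cycle x.
Hypothesis boundary0 : forall y : EMC e k.+1 l, boundary y = 0.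

Definition chain_class (x : EMC e k l) : EMH e k l := hclass (Cycle (cycle_all x)).

Lemma chain_class_is_additive : zmod_morphism chain_class.
Proof.
move=> x y; rewrite /chain_class /hclass -raddfB; congr (\pi_(_) _)%qT.
exact: val_inj.
Qed.
HB.instance Definition _ :=
  GRing.isZmodMorphism.Build (EMC e k l) (EMH e k l) chain_class
    chain_class_is_additive.

Lemma chain_class_val (z : cycles e k l) : chain_class (val z) = hclass z.
Proof. by congr hclass; exact: val_inj. Qed.

Lemma chain_class_inj : injective chain_class.
Proof.
(* Equal classes differ by a boundary, and by [boundary0] the only boundary is 0. *)
move=> x y /eqP; rewrite /chain_class /hclass -Quotient.idealrBE.
rewrite unfold_in => /asboolP[w]; rewrite boundary0 raddfB /= => /esym/eqP.
by rewrite subr_eq0 => /eqP.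
Qed.

Lemma chain_class_bij : bijective chain_class.
Proof.
(* The inverse picks a representing cycle; it is a right inverse, and injectivity makes it
   two-sided. *)
pose g (h : EMH e k l) := val (repr h).
have gK : cancel g chain_class by move=> h; rewrite chain_class_val /hclass reprK.
by exists g => // x; apply: chain_class_inj.
Qed.

End Homology.

Theorem theorem7p3 (V : finType) (e : rel V) (e_sym : symmetric e)
    (l_max : nat) (l_maxP : is_max_eulerian_length e l_max) :
  let k_max := #|V|.-1 in
  (is_connected e -> exists h : EMH e k_max l_max, h != 0) /\
  (exists phi : {additive EMC e k_max l_max -> EMH e k_max l_max},
     bijective phi /\
     forall z : cycles e k_max l_max, phi (val z) = hclass z).
Proof.
move=> k_max.
have cyc (x : EMC e k_max l_max) : is_cycle x.
  by rewrite /is_cycle boundary_max.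
have bd (y : EMC e k_max.+1 l_max) : boundary y = 0 by exact: boundary_above_max.
split=> [conn|]; last first.
  exists (chain_class cyc); split; first exact: chain_class_bij.
  exact: chain_class_val.
have [p] := max_epath_exists conn l_maxP.
exists (chain_class cyc << p >>).
(* Injectivity reduces the claim to chains, where the generator [<< p >>] has coefficient 1 at
   [p]. *)
rewrite -(raddf0 (chain_class cyc)) (inj_eq (chain_class_inj bd)).
apply/eqP => /(congr1 (coeff p)); rewrite coeffU coeff0 eqxx => /eqP.
by rewrite mulr1 oner_eq0.
Qed.
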